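(* Let $\mathcal S=(P,\mathcal L)$ be a $(q,\beta)$-regular partial linear space containing a finite plane $\Pi=(P_\Pi,\mathcal G)$ of order $q$ as a subspace, let $G$ be the point graph of $\mathcal S$, and let $\Gamma_{i,j}$ be the associated twisted partial linear graphs. For every $0\le j\le i\le \lfloor q/2\rfloor$, the graph $\Gamma_{i,j}$ is cospectral with the $2$-clique extension $G^{[2]}$ of $G$.
   Context: All sets and graphs are finite; graphs are simple; two graphs are cospectral if their adjacency matrices have the same spectrum. The $2$-clique extension $G^{[2]}$ is obtained from $G$ by replacing each vertex $x$ by a clique $X$ of order $2$ and joining $X$ completely to $Y$ whenever $x\sim y$ in $G$. A partial linear space is a pair $(P,\mathcal L)$, $\mathcal L$ a set of subsets of $P$ (lines), such that every line has at least two points and every two distinct points lie on at most one line. It is $(s,t)$-regular if every point is on $s+1$ lines and every line has $t+1$ points. $(P',\mathcal L')$ is a subspace of $(P,\mathcal L)$ if $P'\subseteq P$ and $\mathcal L'=\{L\cap P':L\in\mathcal L,\ |L\cap P'|\ge 2\}$. The point graph has vertex set $P$, two distinct points being adjacent iff they lie on a common line. An affine plane of order $q$ is a $(q,q-1)$-regular partial linear space in which for every point $p$ and line $L\not\ni p$ there is a unique line through $p$ disjoint from $L$; a projective plane of order $q$ is a $(q,q)$-regular partial linear space in which any two distinct lines meet in exactly one point. A finite plane of order $q$ is either of these. Throughout $q\ge2$. Construction. Let $\mathcal S$, $\Pi$ be as in the claim. For every $g\in\mathcal G$ there is a unique line $L(g)\in\mathcal L$ with $L(g)\cap P_\Pi=g$.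 Fix a line $\ell_0\in\mathcal G$ and $q$ distinct points $u_1,\dots,u_q\in\ell_0$. For each $a\in[q]=\{1,\dots,q\}$ let $\{\ell_0,\ell_{a,1},\dots,\ell_{a,q}\}$ be the set of the $q+1$ lines of $\Pi$ through $u_a$; when $\Pi$ is affine, the labels are chosen so that for each fixed $b\in[q]$ the lines $\ell_{1,b},\dots,\ell_{q,b}$ are pairwise parallel (disjoint). Put $L_0=L(\ell_0)$, $L_{a,b}=L(\ell_{a,b})$, and $\widetilde a=q+1-a$. For $1\le a\le\lfloor q/2\rfloor$ and $b\in[q]$, twisting the pair $(L_{a,b},L_{\widetilde a,b})$ means replacing these two lines by $(L_{a,b}\setminus\ell_{a,b})\cup\ell_{\widetilde a,b}$ and $(L_{\widetilde a,b}\setminus\ell_{\widetilde a,b})\cup\ell_{a,b}$, respectively, all other lines being kept. For $1\le i\le\lfloor q/2\rfloor$ and $0\le j\le i$ let $T_{i,j}=\{(a,b):1\le a<i,\ 1\le b\le a\}\cup\{(i,b):1\le b\le j\}$, and $T_{0,0}=\varnothing$. Let $P^+=\{x^+:x\in P\}$ and $P^-=\{x^-:x\in P\}$ be disjoint copies of $P$. For each line label $L\in\mathcal L$, let $L^+=\{x^+:x\in L\}$, and let $L^-\subseteq P^-$ be the copy in $P^-$ of the line that replaces $L$ after twisting all pairs $(L_{a,b},L_{\widetilde a,b})$ with $(a,b)\in T_{i,j}$ (the copy of $L$ itself if $L$ is not in such a pair). The twisted partial linear graph $\Gamma_{i,j}$ ($0\le j\le i\le\lfloor q/2\rfloor$)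 has vertex set $P^+\cup P^-$; two distinct vertices $x^\varepsilon,y^\delta$ ($\varepsilon,\delta\in\{+,-\}$) are adjacent iff (1) $x,y\in P_\Pi$, or (2) there is a line label $L\in\mathcal L$ with $x^\varepsilon\in L^\varepsilon$ and $y^\delta\in L^\delta$. *)

(* Defs.v *)
From mathcomp Require Import all_boot all_order all_algebra all_field.

Set Implicit Arguments.
Unset Strict Implicit.
Unset Printing Implicit Defensive.

Import GRing.Theory.

Definition adjacency_mx (V : finType) (e : rel V) : 'M[algC]_#|V| :=
  \matrix_(i, j) (e (enum_val i) (enum_val j))%:R%R.

(* The spectrum is the multiset of eigenvalues, counted with algebraic
   multiplicity.  Adjacency matrices are symmetric integer matrices, so all
   their eigenvalues lie in algC. *)
Definition eigen_multiplicity (n : nat) (A : 'M[algC]_n) (a : algC) : nat :=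
  mup a (char_poly A).

Definition cospectral (V W : finType) (e : rel V) (f : rel W) : Prop :=
  forall a : algC, eigen_multiplicity (adjacency_mx e) a =
                   eigen_multiplicity (adjacency_mx f) a.

Definition clique_extension2 (V : finType) (e : rel V) : rel (V * bool) :=
  fun u v => (u != v) && ((u.1 == v.1) || e u.1 v.1).

(* Point sets are subsets of an ambient finite type T, so that subspaces live
   in the same type as the space containing them. *)
Definition partial_linear_space (T : finType)
    (P : {set T}) (Ls : {set {set T}}) : Prop :=
  [/\ forall L, L \in Ls -> L \subset P,
      forall L, L \in Ls -> 2 <= #|L| &
      forall x y, x \in P -> y \in P -> x != y ->
        #|[set L in Ls | (x \in L) && (y \in L)]| <= 1].

Definition regular_pls (T : finType) (s t : nat)
    (P : {set T}) (Ls : {set {set T}}) : Prop :=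
  [/\ partial_linear_space P Ls,
      forall p, p \in P -> #|[set L in Ls | p \in L]| = s.+1 &
      forall L, L \in Ls -> #|L| = t.+1].

Definition subspace_of (T : finType)
    (P' : {set T}) (Ls' : {set {set T}}) (P : {set T}) (Ls : {set {set T}})
  : Prop :=
  P' \subset P /\ Ls' = [set L :&: P' | L in Ls & 2 <= #|L :&: P'|].

Definition point_graph (T : finType) (Ls : {set {set T}}) : rel T :=
  fun x y => (x != y) && [exists L in Ls, (x \in L) && (y \in L)].

Definition affine_plane (T : finType) (q : nat)
    (P : {set T}) (Ls : {set {set T}}) : Prop :=
  regular_pls q q.-1 P Ls /\
  forall p L, p \in P -> L \in Ls -> p \notin L ->
    #|[set M in Ls | (p \in M) && [disjoint M & L]]| = 1.

Definition projective_plane (T : finType) (q : nat)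
    (P : {set T}) (Ls : {set {set T}}) : Prop :=
  regular_pls q q P Ls /\
  forall L M, L \in Ls -> M \in Ls -> L != M -> #|L :&: M| = 1.

Definition finite_plane (T : finType) (q : nat)
    (P : {set T}) (Ls : {set {set T}}) : Prop :=
  affine_plane q P Ls \/ projective_plane q P Ls.

(* L(g): the line of the ambient space whose trace on P' is g; see
   [lift_lineP] for existence and uniqueness. *)
Definition lift_line (T : finType) (P' : {set T}) (Ls : {set {set T}})
    (g : {set T}) : {set T} :=
  odflt set0 [pick L in Ls | L :&: P' == g].

Lemma lift_lineP (T : finType) (P P' : {set T}) (Ls Ls' : {set {set T}})
    (g : {set T}) :
  partial_linear_space P Ls -> subspace_of P' Ls' P Ls -> g \in Ls' ->
  [/\ lift_line P' Ls g \in Ls, lift_line P' Ls g :&: P' = g &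
      forall L, L \in Ls -> L :&: P' = g -> L = lift_line P' Ls g].
Proof.
case=> subP _ linear [_ ->] /imsetP[L0]; rewrite inE => /andP[L0s g_ge2] ->.
rewrite /lift_line; case: pickP => [M /andP[Ms /eqP trM] | /(_ L0)]; last first.
  by rewrite L0s eqxx.
split=> // L Ls_L trL /=.
have /card_gt1P[x [y [xg yg neq_xy]]] := g_ge2.
have inT N : N :&: P' = L0 :&: P' -> (x \in N) && (y \in N).
  by move=> trN; move: xg yg; rewrite -trN !inE => /andP[-> _] /andP[-> _].
have xyL0 := inT L0 erefl; have /andP[xL0 yL0] := xyL0.
have xP := subsetP (subP _ L0s) _ xL0; have yP := subsetP (subP _ L0s) _ yL0.
have /card_le1_eqP eqL := linear x y xP yP neq_xy.
by apply: eqL; rewrite inE ?Ls_L ?Ms inT.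
Qed.

(* Indices are shifted by one: u a and l a b stand for u_{a+1} and
   l_{a+1,b+1}; the index q+1-a then becomes [rev_ord a].  Since a point of the
   plane is on q+1 lines, the third clause forces ell0, l a 0, ..., l a (q-1)
   to be pairwise distinct. *)
Definition twist_labelling (T : finType) (q : nat)
    (P' : {set T}) (G : {set {set T}})
    (ell0 : {set T}) (u : 'I_q -> T) (l : 'I_q -> 'I_q -> {set T}) : Prop :=
  [/\ ell0 \in G,
      injective u /\ (forall a, u a \in ell0),
      forall a, ell0 |: [set l a b | b : 'I_q] = [set g in G | u a \in g] &
      affine_plane q P' G ->
      forall b a a', a != a' -> [disjoint l a b & l a' b]].

(* Membership of (a+1, b+1) in T_{i,j}. *)
Definition twist_index (q i j : nat) (a b : 'I_q) : bool :=
  ((a.+1 < i) && (b.+1 <= a.+1)) || ((a.+1 == i) && (b.+1 <= j)).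

(* The line replacing L.  A line is affected when it is one of the two lines
   of a pair indexed by T_{i,j}, that is, when it is L(l a b) with (a, b) or
   (rev_ord a, b) in T_{i,j}; the replacement rule is the same for both. *)
Definition twisted_line (T : finType) (q i j : nat)
    (P' : {set T}) (Ls : {set {set T}})
    (l : 'I_q -> 'I_q -> {set T}) (L : {set T}) : {set T} :=
  if [pick ab : 'I_q * 'I_q |
        (twist_index i j ab.1 ab.2 || twist_index i j (rev_ord ab.1) ab.2)
        && (L == lift_line P' Ls (l ab.1 ab.2))] is Some (a, b)
  then (L :\: l a b) :|: l (rev_ord a) b
  else L.

(* (x, true) is x^+ and (x, false) is x^-. *)
Definition twisted_graph (T : finType) (q i j : nat)
    (P' : {set T}) (Ls : {set {set T}}) (l : 'I_q -> 'I_q -> {set T})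
  : rel (T * bool) :=
  let copy (L : {set T}) (sign : bool) :=
    if sign then L else twisted_line i j P' Ls l L in
  fun v w => (v != w) &&
    (((v.1 \in P') && (w.1 \in P'))
     || [exists L in Ls, (v.1 \in copy L v.2) && (w.1 \in copy L w.2)]).

Lemma twisted_graph_sym (T : finType) (q i j : nat)
    (P' : {set T}) (Ls : {set {set T}}) (l : 'I_q -> 'I_q -> {set T}) :
  symmetric (twisted_graph i j P' Ls l).
Proof.
move=> v w; rewrite /twisted_graph eq_sym andbC [(w.1 \in P') && _]andbC andbC.
by congr (_ && (_ || _)); apply: eq_existsb => L; congr (_ && _); exact: andbC.
Qed.

Lemma twisted_graph_irrefl (T : finType) (q i j : nat)
    (P' : {set T}) (Ls : {set {set T}}) (l : 'I_q -> 'I_q -> {set T}) :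
  irreflexive (twisted_graph i j P' Ls l).
Proof. by move=> v; rewrite /twisted_graph eqxx. Qed.

(* Main.v *)
(* Let K be the set of vertices of Gamma_{i,j} over the plane; K is a clique,
   and so is the corresponding set in the clique extension.  Writing A + I in
   blocks with respect to the complement of K and K as [[B, D], [D^T, J]], its
   characteristic polynomial depends only on B, D D^T and D 1, as one sees by
   factoring A + I through the complement of K (twice) and the all-one vector of
   K and exchanging the two factors.  Twisting changes neither B nor D D^T and
   D 1: the entries of D D^T are sums of numbers |L /\ M /\ P'| over lines L and
   M of the space, and twisting permutes the traces of the lines on the plane,
   each trace being replaced, if the plane is affine, by a parallel one. *)
Require Import Defs.
From mathcomp Require Import all_boot all_order all_algebra all_field.

Set Implicit Arguments.
Unset Strict Implicit.
Unset Printing Implicit Defensive.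

Import GRing.Theory.

(** * Determinants and characteristic polynomials of block matrices *)

Section LinearAlgebra.
Local Open Scope ring_scope.

(** Clearing the block [Y] of [Z] by a column operation and by a row operation yields the two
    determinants; scaling rows by [c] avoids a division. *)
Lemma det_sub_mulmxC (R : comNzRingType) (m n : nat) (c : R)
    (X : 'M[R]_(m, n)) (Y : 'M[R]_(n, m)) :
  c ^+ n * \det (c%:M - X *m Y) = c ^+ m * \det (c%:M - Y *m X).
Proof.
pose Z := block_mx c%:M X Y 1%:M.
have detL : \det Z = \det (c%:M - X *m Y).
  have := det_mulmx Z (block_mx 1%:M 0 (- Y) 1%:M).
  rewrite mulmx_block det_lblock !det1 !mulr1 !mulmx1 !mul1mx !mulmx0 !add0r.
  by rewrite subrr mulmxN det_ublock det1 mulr1.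
have := det_mulmx (block_mx 1%:M 0 (- Y) c%:M) Z.
rewrite mulmx_block det_lblock detL !det_scalar expr1n !mul1r.
rewrite !mul1mx !mul0mx !addr0 !mulmx1 mulNmx mulNmx mul_mx_scalar mul_scalar_mx.
by rewrite addNr det_ublock det_scalar addrC => ->.
Qed.

(** With [p' = 1 - p], a matrix [C] is the sum of [p C], [p' C p] and [p' C p'], and the last
    summand factors through [r] and [s]. The equalities assumed between [A] and [B] are the blocks
    of the reversed product that involve the matrix. *)
Lemma det_sub_compression (R : idomainType) (n k : nat) (c : R)
    (A B p : 'M[R]_n) (r : 'M[R]_(n, k)) (s : 'M[R]_(k, n)) :
  c != 0 -> p *m p = p -> p *m r = 0 -> s *m p = 0 ->
  (1%:M - p) *m A *m (1%:M - p) = r *m s ->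
  (1%:M - p) *m B *m (1%:M - p) = r *m s ->
  p *m A *m p = p *m B *m p ->
  p *m A *m (1%:M - p) *m A *m p = p *m B *m (1%:M - p) *m B *m p ->
  p *m A *m r = p *m B *m r -> s *m A *m p = s *m B *m p ->
  \det (c%:M - A) = \det (c%:M - B).
Proof.
move=> c0 pp pr sp Ars Brs AB ABAB ABr sAB.
pose p' := 1%:M - p.
(* A and B factor as [X C *m Y C], and [Y C *m X C] is the same for both. *)
pose X C := row_mx p (row_mx (p' *m C *m p) r).
pose Y C := col_mx (p *m C) (col_mx p s).
have XY C : p' *m C *m p' = r *m s -> X C *m Y C = C.
  move=> Crs; rewrite !mul_row_col -Crs mulmxA pp -[_ *m p *m p]mulmxA pp.
  by rewrite -mulmxDr [p + p']addrC subrK mulmx1 -mulmxDl [p + p']addrC subrK mul1mx.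
have p'p : p *m p' = 0 by rewrite mulmxBr pp mulmx1 subrr.
have sp' : s *m p' = s by rewrite mulmxBr sp mulmx1 subr0.
have YX : Y A *m X A = Y B *m X B.
  rewrite !mul_col_row !mul_mx_row !mul_col_mx !mulmxA pp pr sp p'p sp' !mul0mx.
  by rewrite AB ABAB ABr sAB.
apply: (mulfI (expf_neq0 (n + (n + k)) c0)).
have := det_sub_mulmxC c (X A) (Y A); have := det_sub_mulmxC c (X B) (Y B).
by rewrite (XY _ Ars) (XY _ Brs) YX => -> ->.
Qed.

(** The determinant identity is applied over polynomials, at the nonzero scalar ['X + a]. The shift
    is there because the adjacency matrix of a clique has rank one only after adding the
    identity. *)
Lemma char_poly_compression (R : idomainType) (n k : nat) (a : R)
    (A B p : 'M[R]_n) (r : 'M[R]_(n, k)) (s : 'M[R]_(k, n)) :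
  p *m p = p -> p *m r = 0 -> s *m p = 0 ->
  let A' := A + a%:M in let B' := B + a%:M in
  (1%:M - p) *m A' *m (1%:M - p) = r *m s ->
  (1%:M - p) *m B' *m (1%:M - p) = r *m s ->
  p *m A' *m p = p *m B' *m p ->
  p *m A' *m (1%:M - p) *m A' *m p = p *m B' *m (1%:M - p) *m B' *m p ->
  p *m A' *m r = p *m B' *m r -> s *m A' *m p = s *m B' *m p ->
  char_poly A = char_poly B.
Proof.
move=> pp pr sp A' B' Ars Brs AB ABAB ABr sAB.
pose h m1 m2 (M : 'M[R]_(m1, m2)) := map_mx (polyC : R -> {poly R}) M.
have shift C : char_poly C = \det (('X + a%:P)%:M - h _ _ (C + a%:M)).
  by rewrite /h map_mxD map_scalar_mx [(_ + _)%:M]raddfD /= opprD addrACA subrr addr0.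
have hp : 1%:M - h _ _ p = h _ _ (1%:M - p) by rewrite /h map_mxB map_mx1.
rewrite !shift; apply: (@det_sub_compression _ _ _ _ _ _ (h _ _ p) (h _ _ r) (h _ _ s));
  rewrite ?hp -?map_mxM ?pp ?pr ?sp ?Ars ?Brs ?AB ?ABAB ?ABr ?sAB ?map_mx0 //.
by rewrite -[a]opprK polyCN polyXsubC_eq0.
Qed.

(** Compression with [a = 1] and [k = 1]: adding the identity makes the block on [S] all-one, hence
    [r *m r^T]. The sums over [S] are the entries outside [S] of the products through [S] and with
    [r]. *)
Lemma char_poly_switch (R : idomainType) (n : nat) (S : pred 'I_n)
    (A B : 'M[R]_n) :
  A^T = A -> B^T = B ->
  {in S &, forall i j, A i j = (i != j)%:R} ->
  {in S &, forall i j, B i j = (i != j)%:R} ->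
  {in predC S &, forall i j, A i j = B i j} ->
  {in predC S &, forall i j,
     \sum_(k in S) A i k * A j k = \sum_(k in S) B i k * B j k} ->
  {in predC S, forall i, \sum_(k in S) A i k = \sum_(k in S) B i k} ->
  char_poly A = char_poly B.
Proof.
move=> Asym Bsym AS BS AB AA Adeg.
(* [diag_mx (d true)] projects onto [S]; [diag_mx (d false)] projects onto its complement and serves
   as [p]. *)
pose d (b : bool) : 'rV[R]_n := \row_i ((i \in S) == b)%:R.
pose r : 'cV[R]_n := \col_i (i \in S)%:R.
have dC : 1%:M - diag_mx (d false) = diag_mx (d true).
  apply/eqP; rewrite subr_eq -raddfD -diag_const_mx; apply/eqP; congr diag_mx.
  by apply/rowP => i; rewrite !mxE; case: (i \in S); rewrite /= ?addr0 ?add0r.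
have clique (C : 'M[R]_n) : {in S &, forall i j, C i j = (i != j)%:R} ->
    diag_mx (d true) *m (C + 1%:M) *m diag_mx (d true) = r *m r^T.
  move=> CS; apply/matrixP => i j.
  rewrite mul_mx_diag mul_diag_mx !mxE big_ord1 !mxE !eqb_id.
  case: (boolP (i \in S)) => iS; last by rewrite !mul0r.
  case: (boolP (j \in S)) => jS; last by rewrite !mulr0.
  by rewrite !mul1r !mulr1 CS //; case: eqP; rewrite ?add0r ?addr0.
have tr (C : 'M[R]_n) : C^T = C -> forall i j, C i j = C j i by move=> CT i j; rewrite -[in LHS]CT mxE.
(* Hence the added identity does not touch entries between [S] and its complement. *)
have neq i k : i \notin S -> k \in S -> (i == k) = false.
  by move=> iS kS; apply: contraNF iS => /eqP->.
have deg (C : 'M[R]_n) i j : i \notin S -> ((C + 1%:M) *m r) i j = \sum_(k in S) C i k.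
  move=> iS; rewrite mxE [RHS]big_mkcond; apply: eq_bigr => k _; rewrite !mxE.
  case: (boolP (k \in S)) => kS; last by rewrite mulr0.
  by rewrite neq // addr0 mulr1.
have sums (C : 'M[R]_n) i j : C^T = C -> i \notin S -> j \notin S ->
    ((C + 1%:M) *m diag_mx (d true) *m (C + 1%:M)) i j
      = \sum_(k in S) C i k * C j k.
  move=> CT iS jS; rewrite mul_mx_diag mxE [RHS]big_mkcond.
  apply: eq_bigr => k _; rewrite !mxE eqb_id.
  case: (boolP (k \in S)) => kS; last by rewrite mulr0 mul0r.
  by rewrite [k == j]eq_sym !neq // !addr0 mulr1 (tr C CT k j).
have ABr : diag_mx (d false) *m (A + 1%:M) *m r = diag_mx (d false) *m (B + 1%:M) *m r.
  apply/matrixP => i j; rewrite -!mulmxA !mul_diag_mx 2!mxE.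
  rewrite [d _ _ _]mxE eqbF_neg.
  case: (boolP (i \in S)) => iS; first by rewrite !mul0r.
  by rewrite !deg ?Adeg.
apply: (@char_poly_compression _ _ _ 1 _ _ (diag_mx (d false)) r r^T).
- rewrite mulmx_diag; congr diag_mx; apply/rowP => i; rewrite !mxE.
  by rewrite -natrM mulnb andbb.
- apply/matrixP => i j; rewrite mul_diag_mx !mxE.
  by case: (_ \in S); rewrite ?mulr0 ?mul0r.
- apply/matrixP => i j; rewrite mul_mx_diag !mxE.
  by case: (_ \in S); rewrite ?mulr0 ?mul0r.
- by rewrite dC clique.
- by rewrite dC clique.
- apply/matrixP => i j; rewrite !mul_mx_diag !mul_diag_mx !mxE !eqbF_neg.
  case: (boolP (i \in S)) => iS; first by rewrite !mul0r.
  case: (boolP (j \in S)) => jS; first by rewrite !mulr0.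
  by rewrite AB.
- have E (C : 'M[R]_n) : C^T = C -> diag_mx (d false) *m (C + 1%:M) *m diag_mx (d true)
      *m (C + 1%:M) *m diag_mx (d false) =
     \matrix_(i, j) (d false 0 i * (\sum_(k in S) C i k * C j k) * d false 0 j).
    move=> CT; rewrite mul_mx_diag -!mulmxA mul_diag_mx mulmxA.
    apply/matrixP => i j; rewrite 2!mxE [RHS]mxE ![d _ _ _]mxE !eqbF_neg.
    case: (boolP (i \in S)) => iS; first by rewrite !mul0r.
    case: (boolP (j \in S)) => jS; first by rewrite !mulr0.
    by rewrite sums.
  rewrite dC !E //; apply/matrixP => i j; rewrite mxE [RHS]mxE ![d _ _ _]mxE.
  rewrite !eqbF_neg; case: (boolP (i \in S)) => iS; first by rewrite !mul0r.
  case: (boolP (j \in S)) => jS; first by rewrite !mulr0.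
  by rewrite AA.
- exact: ABr.
(* By symmetry of both matrices this is the transpose of [ABr]. *)
- by apply: trmx_inj; rewrite !trmx_mul !trmxK !tr_diag_mx !raddfD /= Asym Bsym !tr_scalar_mx !mulmxA.
Qed.

End LinearAlgebra.

(** The sums in [char_poly_switch] count common neighbours in [K]; the case [x = y] gives the
    degrees into [K]. *)
Lemma clique_switch_cospectral (V : finType) (K : {set V}) (e f : rel V) :
  symmetric e -> symmetric f ->
  {in K &, forall x y, e x y = (x != y)} ->
  {in K &, forall x y, f x y = (x != y)} ->
  {in ~: K &, e =2 f} ->
  {in ~: K &, forall x y, #|[set z in K | e x z && e y z]|
                        = #|[set z in K | f x z && f y z]|} ->
  cospectral e f.
Proof.
move=> esym fsym eK fK ef count a; congr (mup a _).
have common (g : rel V) (i j : 'I_#|V|) :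
    (\sum_(k | enum_val k \in K) adjacency_mx g i k * adjacency_mx g j k
      = #|[set z in K | g (enum_val i) z && g (enum_val j) z]|%:R)%R.
  rewrite -[#|finset _|]sum1_card natr_sum big_mkcond [RHS]big_mkcond /=.
  rewrite [RHS](reindex _ (onW_bij _ (@enum_val_bij V))); apply: eq_bigr => k _.
  by rewrite !mxE -natrM mulnb !inE; case: (_ \in K) => //=; case: (_ && _).
have degree (g : rel V) (i : 'I_#|V|) :
    (\sum_(k | enum_val k \in K) adjacency_mx g i k
      = #|[set z in K | g (enum_val i) z && g (enum_val i) z]|%:R)%R.
  by rewrite -common; apply: eq_bigr => k _; rewrite !mxE -natrM mulnb andbb.
have sym (g : rel V) : symmetric g -> ((adjacency_mx g)^T = adjacency_mx g)%R.
  by move=> gsym; apply/matrixP => i j; rewrite !mxE gsym.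
apply: (@char_poly_switch _ _ [pred i | enum_val i \in K]); rewrite ?sym //.
- by move=> i j iK jK; rewrite mxE eK // (inj_eq enum_val_inj).
- by move=> i j iK jK; rewrite mxE fK // (inj_eq enum_val_inj).
- by move=> i j iK jK; rewrite !mxE ef // inE.
- by move=> i j iK jK; rewrite !common count // inE.
- by move=> i iK; rewrite !degree count // inE.
Qed.

(** * Incidence in partial linear spaces and finite planes *)

Lemma pls_line_unique (T : finType) (P : {set T}) (Ls : {set {set T}})
    (x y : T) (L M : {set T}) :
  partial_linear_space P Ls -> L \in Ls -> M \in Ls -> x != y ->
  x \in L -> y \in L -> x \in M -> y \in M -> L = M.
Proof.
move=> [subP _ linear] Ls_L Ls_M xy xL yL xM yM.
have LP := subsetP (subP _ Ls_L).
have /card_le1_eqP eqL := linear x y (LP _ xL) (LP _ yL) xy.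
by apply: eqL; rewrite inE ?Ls_L ?Ls_M ?xL ?yL ?xM ?yM.
Qed.

Lemma pls_card_lineI (T : finType) (P : {set T}) (Ls : {set {set T}})
    (L M : {set T}) :
  partial_linear_space P Ls -> L \in Ls -> M \in Ls -> L != M ->
  #|L :&: M| <= 1.
Proof.
move=> pls Ls_L Ls_M; apply: contraNT; rewrite -ltnNge.
case/card_gt1P=> x [y []]; rewrite !inE => /andP[xL xM] /andP[yL yM] xy.
by apply/eqP; apply: (pls_line_unique pls) xy _ _ _ _.
Qed.

Section FinitePlane.

Variables (T : finType) (q : nat) (P : {set T}) (G : {set {set T}}).
Hypothesis plane : finite_plane q P G.

Lemma finite_plane_regular : exists t, regular_pls q t P G.
Proof. by case: plane => -[reg _]; eexists; exact: reg. Qed.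

Lemma finite_plane_pls : partial_linear_space P G.
Proof. by case: finite_plane_regular => t []. Qed.

Lemma finite_plane_lines (x : T) : x \in P -> #|[set g in G | x \in g]| = q.+1.
Proof. by case: finite_plane_regular => t [_ + _] => /[apply]. Qed.

(** Take a line [L] on [y] but not on [x]. Lines on [x] that meet [L] do so in distinct points, and
    there are at least [#|L|] of them, so one passes through [y]. *)
Lemma finite_plane_collinear : 0 < q ->
  {in P &, forall x y, exists2 g, g \in G & (x \in g) && (y \in g)}.
Proof.
move=> q0 x y xP yP.
have /card_gt0P[L] : 0 < #|[set g in G | y \in g]| by rewrite finite_plane_lines.
rewrite inE => /andP[GL yL].
case: (boolP (x \in L)) => xL; first by exists L; rewrite ?xL.
pose meeting := [set g in G | (x \in g) && ~~ [disjoint g & L]].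
have meet_card : #|L| <= #|meeting|.
  (* Affine case: one of the [q.+1] lines on [x] misses [L], which leaves [q = #|L|]. Projective
     case: all [q.+1] meet [L]. *)
  have := finite_plane_lines xP; case: plane => -[[_ _ line_size] axiom].
    rewrite (line_size _ GL) (prednK q0).
    have := axiom x L xP GL xL.
    set D := [set M in G | _]; move=> cD.
    have -> : [set g in G | x \in g] = meeting :|: D.
      by apply/setP => g; rewrite !inE; case: (g \in G); case: (x \in g); case: [disjoint _ & _].
    by move=> cU; have [+ _] := leq_card_setU meeting D; rewrite cU cD addn1 ltnS.
  rewrite (line_size _ GL) => <-; apply: subset_leq_card; apply/subsetP => g.
  rewrite !inE => /andP[Gg xg]; rewrite Gg xg -setI_eq0 -cards_eq0 axiom //.
  by apply: contraNneq xL => <-.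
(* The default [x] is never reached on [meeting]. *)
pose f g := odflt x [pick z in g :&: L].
have fP g : g \in meeting -> f g \in g :&: L.
  rewrite inE -setI_eq0 => /and3P[_ _ /set0Pn[z zgL]]; rewrite /f.
  by case: pickP => [//|/(_ z)]; rewrite zgL.
have f_inj : {in meeting &, injective f}.
  move=> g h gm hm fgh; have := fP h hm; have := fP g gm; rewrite -fgh.
  rewrite !inE => /andP[fg fL] /andP[fh _].
  move: gm hm; rewrite !inE => /and3P[Gg xg _] /and3P[Gh xh _].
  apply: (pls_line_unique finite_plane_pls Gg Gh) xg fg xh fh.
  by apply: contraNneq xL => ->.
have fL : f @: meeting = L.
  apply/eqP; rewrite eqEcard card_in_imset // meet_card andbT.
  by apply/subsetP => _ /imsetP[g /fP + ->]; rewrite inE => /andP[].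
have: y \in f @: meeting by rewrite fL.
case/imsetP => g gm yE; have := fP g gm; rewrite -yE inE => /andP[yg _].
by move: gm; rewrite inE => /and3P[Gg xg _]; exists g; rewrite ?xg.
Qed.

(** A common point of [g] and [k] off [h] would carry two parallels to [h]. *)
Lemma affine_disjoint_trans (g h k : {set T}) :
  affine_plane q P G -> g \in G -> h \in G -> k \in G ->
  (g == h) || [disjoint g & h] -> (h == k) || [disjoint h & k] ->
  (g == k) || [disjoint g & k].
Proof.
move=> [_ axiom] Gg Gh Gk /orP[/eqP-> //|gh] /orP[/eqP<-|hk].
  by rewrite gh orbT.
case: (boolP [disjoint g & k]); rewrite ?orbT // orbF -setI_eq0.
case/set0Pn => p /setIP[pg pk].
have ph : p \notin h by rewrite (disjointFr gh pg).
have pP : p \in P by case: finite_plane_pls => /(_ g Gg)/subsetP/(_ p pg).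
have /eqP/cards1P[m mE] := axiom p h pP Gh ph.
have : g \in [set m] by rewrite -mE inE Gg pg.
have : k \in [set m] by rewrite -mE inE Gk pk disjoint_sym.
by rewrite !inE => /eqP-> ->.
Qed.

(* In a projective plane any two lines meet in one point, so every permutation
   of the lines will do. *)
Lemma card_lineI_parallel_perm (sigma : {set T} -> {set T}) :
  {in G, forall g, sigma g \in G} -> {in G &, injective sigma} ->
  (affine_plane q P G ->
     {in G, forall g, (g == sigma g) || [disjoint g & sigma g]}) ->
  {in G &, forall g h, #|sigma g :&: sigma h| = #|g :&: h|}.
Proof.
move=> sG sinj spar g h Gg Gh.
have [<-|gh] := eqVneq g h.
  have [t [_ _ line_size]] := finite_plane_regular.
  by rewrite !setIid !line_size ?sG.
have sgh : sigma g != sigma h by rewrite (inj_in_eq sinj).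
case: plane => -[reg axiom]; last by rewrite !axiom ?sG.
have {axiom reg}aff : affine_plane q P G by [].
(* Parallelism is an equivalence relation and [sigma] preserves each parallel class. *)
have disj : [disjoint sigma g & sigma h] = [disjoint g & h].
  have par_sym (x y : {set T}) :
      (x == y) || [disjoint x & y] -> (y == x) || [disjoint y & x].
    by rewrite eq_sym disjoint_sym.
  have trans := affine_disjoint_trans aff; have par := spar aff.
  have par' k : k \in G -> (sigma k == k) || [disjoint sigma k & k].
    by move=> Gk; apply/par_sym/par.
  apply/idP/idP => d; [rewrite -(orFb [disjoint _ & _]) -(negPf gh)
                      |rewrite -(orFb [disjoint _ & _]) -(negPf sgh)].
    apply: (trans _ (sigma h)); rewrite ?sG ?par' //.
    by apply: (trans _ (sigma g)); rewrite ?sG ?par // d orbT.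
  apply: (trans _ h); rewrite ?sG ?par //.
  by apply: (trans _ g); rewrite ?sG ?par' // d orbT.
have pls := finite_plane_pls.
have le1 := pls_card_lineI pls Gg Gh gh.
have sle1 := pls_card_lineI pls (sG _ Gg) (sG _ Gh) sgh.
(* Both sizes are at most one, so emptiness determines them. *)
have eq0 : (#|sigma g :&: sigma h| == 0) = (#|g :&: h| == 0).
  by rewrite !cards_eq0 !setI_eq0.
by move: le1 sle1 eq0; case: #|_| => [|[]] //; case: #|_| => [|[]].
Qed.

End FinitePlane.

(** * The permutation of the plane lines induced by twisting *)

Section Labelling.

Variables (T : finType) (q : nat) (P' : {set T}) (G : {set {set T}}).
Variables (ell0 : {set T}) (u : 'I_q -> T) (l : 'I_q -> 'I_q -> {set T}).
Hypothesis plane : finite_plane q P' G.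
Hypothesis labelling : twist_labelling P' G ell0 u l.

Lemma label_line (a b : 'I_q) : l a b \in G /\ u a \in l a b.
Proof.
have [_ _ pencil _] := labelling; apply/andP.
have: l a b \in ell0 |: [set l a b | b : 'I_q] by rewrite in_setU1 imset_f ?orbT.
by rewrite pencil inE.
Qed.

Lemma label_pencil (a : 'I_q) :
  injective (l a) /\ ell0 \notin [set l a b | b : 'I_q].
Proof.
have [Gell0 [_ ul] pencil _] := labelling.
have uP : u a \in P'.
  by have [/(_ _ Gell0)/subsetP/(_ _ (ul a))] := finite_plane_pls plane.
have := finite_plane_lines plane uP; rewrite -pencil cardsU1.
have := leq_imset_card (l a) 'I_q; rewrite card_ord.
case: (boolP (ell0 \in _)) => /= _ le; first by rewrite add0n => E; rewrite E ltnn in le.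
rewrite add1n => -[E]; split=> // b b'.
have /imset_injP inj : #|[set l a b | b : 'I_q]| == #|'I_q| by rewrite E card_ord.
exact: inj.
Qed.

(** If [a] and [a'] differ, the common line contains two points of [ell0], so it is [ell0], which
    [label_pencil] excludes from the labels. *)
Lemma label_inj (a a' b b' : 'I_q) : l a b = l a' b' -> a = a' /\ b = b'.
Proof.
have [Gell0 [u_inj ul] _ _] := labelling => E.
have [aa'|naa'] := eqVneq a a'.
  by rewrite -aa' in E *; case: (label_pencil a) => inj _; rewrite (inj _ _ E).
have [Gl ual] := label_line a b; have [_] := label_line a' b'; rewrite -E => ua'l.
case: (label_pencil a) => _ /negP[]; apply/imsetP; exists b => //.
apply: (pls_line_unique (finite_plane_pls plane) Gell0 Gl) (ul a) (ul a') ual ua'l.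
by rewrite (inj_eq u_inj).
Qed.

Definition twisted_trace (i j : nat) (g : {set T}) : {set T} :=
  if [pick ab : 'I_q * 'I_q |
        (twist_index i j ab.1 ab.2 || twist_index i j (rev_ord ab.1) ab.2)
        && (g == l ab.1 ab.2)] is Some (a, b)
  then l (rev_ord a) b else g.

Variant twisted_trace_spec (i j : nat) (g : {set T}) : {set T} -> Prop :=
| TwistedTrace a b of twist_index i j a b || twist_index i j (rev_ord a) b
    & g = l a b : twisted_trace_spec i j g (l (rev_ord a) b)
| UntwistedTrace
    of (forall a b, twist_index i j a b || twist_index i j (rev_ord a) b ->
          g != l a b) : twisted_trace_spec i j g g.

Lemma twisted_traceP (i j : nat) (g : {set T}) :
  twisted_trace_spec i j g (twisted_trace i j g).
Proof.
rewrite /twisted_trace; case: pickP => [[a b] /= /andP[tw /eqP gE]|none].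
  exact: TwistedTrace.
by apply: UntwistedTrace => a b tw; have := none (a, b); rewrite /= tw => /negbT.
Qed.

Lemma twisted_trace_line (i j : nat) (g : {set T}) :
  g \in G -> twisted_trace i j g \in G.
Proof. by case: twisted_traceP => // a b _ _ _; case: (label_line (rev_ord a) b). Qed.

(** The affected index pairs are stable under [rev_ord] on the first index, so the image of an
    affected line is never an unaffected line. *)
Lemma twisted_trace_inj (i j : nat) : injective (twisted_trace i j).
Proof.
have rev_tw (a b : 'I_q) : twist_index i j a b || twist_index i j (rev_ord a) b ->
    twist_index i j (rev_ord a) b || twist_index i j (rev_ord (rev_ord a)) b.
  by rewrite rev_ordK orbC.
move=> g h; case: twisted_traceP => [a b tw ->|no]; case: twisted_traceP => [a' b' tw' ->|no'] //.
- by case/label_inj => /rev_ord_inj-> ->.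
- by move=> E; case/eqP: (no' _ _ (rev_tw _ _ tw)).
- by move=> E; case/eqP: (no _ _ (rev_tw _ _ tw')).
Qed.

(** Twisting keeps the second index [b], and in an affine plane labels with the same [b] are
    parallel; a middle index [a = rev_ord a] is fixed. *)
Lemma card_twisted_traceI (i j : nat) :
  {in G &, forall g h,
     #|twisted_trace i j g :&: twisted_trace i j h| = #|g :&: h|}.
Proof.
apply: (card_lineI_parallel_perm plane).
- exact: twisted_trace_line.
- by move=> g h _ _; apply: twisted_trace_inj.
move=> aff g Gg; case: twisted_traceP => [a b _ ->|_]; last by rewrite eqxx.
have [<-|neq] := eqVneq a (rev_ord a); first by rewrite eqxx.
by have [_ _ _ /(_ aff)->] := labelling; rewrite ?orbT.
Qed.

End Labelling.

(** * Traces on the plane of the lines of the space *)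

Section TwistedLines.

Variables (T : finType) (q beta : nat) (Ls : {set {set T}}).
Variables (P' : {set T}) (G : {set {set T}}).
Variables (ell0 : {set T}) (u : 'I_q -> T) (l : 'I_q -> 'I_q -> {set T}).
Hypothesis space : regular_pls q beta [set: T] Ls.
Hypothesis plane : finite_plane q P' G.
Hypothesis subspace : subspace_of P' G [set: T] Ls.
Hypothesis labelling : twist_labelling P' G ell0 u l.

Let space_pls : partial_linear_space [set: T] Ls.
Proof. by case: space. Qed.

(* All q+1 lines of the space through a point of the plane come from the q+1
   lines of the plane through it. *)
Lemma line_trace (L : {set T}) : L \in Ls -> L :&: P' != set0 -> L :&: P' \in G.
Proof.
have [_ GE] := subspace; move=> Ls_L /set0Pn[z /setIP[zL zP]].
pose X := [set M in Ls | (z \in M) && (2 <= #|M :&: P'|)].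
have XE : X = [set M in Ls | z \in M].
  apply/eqP; rewrite eqEcard; apply/andP; split.
    by apply/subsetP => M; rewrite !inE => /and3P[-> ->].
  have [_ -> // _] := space; rewrite -(finite_plane_lines plane zP).
  apply: leq_trans (leq_imset_card (fun M => M :&: P') X); apply: subset_leq_card.
  apply/subsetP => g; rewrite inE GE => /andP[/imsetP[M]].
  rewrite inE => /andP[Ls_M ge2] -> /setIP[zM _].
  by apply/imsetP; exists M; rewrite // inE Ls_M zM.
have: L \in X by rewrite XE inE Ls_L.
by rewrite inE GE => /and3P[_ _ ge2]; apply/imsetP; exists L; rewrite // inE Ls_L.
Qed.

Lemma eq_lift_line (L g : {set T}) :
  L \in Ls -> g \in G -> (L == lift_line P' Ls g) = (L :&: P' == g).
Proof.
move=> Ls_L Gg; have [_ tr uniq] := lift_lineP space_pls subspace Gg.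
by apply/eqP/eqP => [->//|]; apply: uniq.
Qed.

Lemma label_subset (a b : 'I_q) : l a b \subset P'.
Proof.
by have [sub _ _] := finite_plane_pls plane; apply: sub; case: (label_line labelling a b).
Qed.

Lemma twisted_lineI (i j : nat) (L : {set T}) :
  L \in Ls -> twisted_line i j P' Ls l L :&: P' = twisted_trace l i j (L :&: P').
Proof.
move=> Ls_L; rewrite /twisted_line /twisted_trace.
(* After this rewriting both definitions pick by the same predicate, hence make the same choice. *)
under eq_pick => ab do rewrite eq_lift_line ?(proj1 (label_line labelling _ _)) //.
case: pickP => [[a b] /= /andP[_ /eqP LE]|//].
rewrite setIUl setIDAC LE setDv set0U; apply/setIidPl; exact: label_subset.
Qed.

Lemma mem_twisted_line_out (i j : nat) (L : {set T}) (x : T) :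
  x \notin P' -> (x \in twisted_line i j P' Ls l L) = (x \in L).
Proof.
move=> xP; rewrite /twisted_line; case: pickP => [[a b] _|//].
have xl a' b' : x \notin l a' b' by apply: contra xP; apply/subsetP/label_subset.
by rewrite !inE (negPf (xl _ _)) (negPf (xl _ _)) orbF.
Qed.

Lemma card_twisted_lineI (i j : nat) :
  {in Ls &, forall L M,
     #|twisted_line i j P' Ls l L :&: twisted_line i j P' Ls l M :&: P'|
       = #|L :&: M :&: P'|}.
Proof.
move=> L M Ls_L Ls_M; rewrite setIIl [L :&: M :&: P']setIIl !twisted_lineI //.
(* A line missing the plane has an empty trace, outside [G]; it is no label, since labels contain
   some [u a]. *)
have trace0 : twisted_trace l i j set0 = set0.
  case: twisted_traceP => // a b _ E; have [_] := label_line labelling a b.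
  by rewrite -E inE.
have [->|LG] := eqVneq (L :&: P') set0; first by rewrite trace0 !set0I.
have [->|MG] := eqVneq (M :&: P') set0; first by rewrite trace0 !setI0.
by apply: (card_twisted_traceI plane labelling); apply: line_trace.
Qed.

(* Distinct lines through a point outside the plane have disjoint traces on the
   plane, and this is preserved by phi; so each common neighbour is counted by
   exactly one pair of lines. *)
Lemma card_common_trace (phi : {set T} -> {set T}) (x y : T) :
  {in Ls &, forall L M, #|phi L :&: phi M :&: P'| = #|L :&: M :&: P'|} ->
  x \notin P' -> y \notin P' ->
  #|[set z in P' | [exists L in Ls, (x \in L) && (z \in phi L)]
                && [exists L in Ls, (y \in L) && (z \in phi L)]]|
    = \sum_(L in Ls | x \in L) \sum_(M in Ls | y \in M) #|L :&: M :&: P'|.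
Proof.
move=> phiI xP yP.
have incidence z w : z \in P' -> w \notin P' ->
    [exists L in Ls, (w \in L) && (z \in phi L)]
      = \sum_(L in Ls | w \in L) (z \in phi L) :> nat.
  move=> zP wP; case: existsP => [[L /and3P[Ls_L wL zL]]|none].
    rewrite (bigD1 L) ?Ls_L //= zL big1 ?addn0 // => M /andP[/andP[Ls_M wM] ML].
    apply/eqP; rewrite eqb0; apply/negP => zM.
    (* By [phiI] the meeting of the images forces [L] and [M] to share a plane point besides [w],
       hence to be equal. *)
    have : 0 < #|phi M :&: phi L :&: P'|.
      by apply/card_gt0P; exists z; rewrite !inE zM zL.
    rewrite phiI // => /card_gt0P[v]; rewrite !inE => /andP[/andP[vM vL] vP].
    case/eqP: ML; apply: (pls_line_unique space_pls Ls_M Ls_L) vM wM vL wL.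
    by apply: contraNneq wP => <-.
  rewrite big1 // => L /andP[Ls_L wL]; apply/eqP; rewrite eqb0.
  by apply/negP => zL; case: none; exists L; rewrite Ls_L wL.
transitivity (\sum_(z in P') \sum_(L in Ls | x \in L) \sum_(M in Ls | y \in M)
                (z \in phi L) * (z \in phi M)).
  rewrite -sum1_card big_mkcond [RHS]big_mkcond /=; apply: eq_bigr => z _.
  rewrite inE; case: (boolP (z \in P')) => //= zP.
  under eq_bigr => L _ do rewrite -big_distrr /=.
  by rewrite -big_distrl /= -!incidence // mulnb; case: (_ && _).
rewrite exchange_big /=; apply: eq_bigr => L /andP[Ls_L _].
rewrite exchange_big /=; apply: eq_bigr => M /andP[Ls_M _].
rewrite -phiI // -sum1_card big_mkcond [RHS]big_mkcond /=; apply: eq_bigr => z _.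
by rewrite !inE mulnb; case: (z \in P'); rewrite ?andbF ?andbT //; case: (_ && _).
Qed.

End TwistedLines.

(** * Comparison of the two graphs *)

Lemma card_set_pair (T U : finType) (F : T -> U -> bool) :
  #|[set v : T * U | F v.1 v.2]| = \sum_(y : U) #|[set x | F x y]|.
Proof.
rewrite -sum1dep_card big_mkcond /= -(pair_bigA _ (fun x y => if F x y then 1 else 0)).
by rewrite exchange_big; apply: eq_bigr => y _; rewrite -sum1dep_card [RHS]big_mkcond.
Qed.

Theorem theorem4p5 (T : finType) (q beta : nat)
    (Ls : {set {set T}}) (P' : {set T}) (G : {set {set T}})
    (ell0 : {set T}) (u : 'I_q -> T) (l : 'I_q -> 'I_q -> {set T}) :
  2 <= q ->
  regular_pls q beta [set: T] Ls ->
  finite_plane q P' G ->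
  subspace_of P' G [set: T] Ls ->
  twist_labelling P' G ell0 u l ->
  forall i j : nat, j <= i -> i <= q./2 ->
  cospectral (twisted_graph i j P' Ls l)
             (clique_extension2 (point_graph Ls)).
Proof.
move=> q2 space plane subspace labelling i j _ _.
pose phi (b : bool) L := if b then L else twisted_line i j P' Ls l L.
have phi_out b L x : x \notin P' -> (x \in phi b L) = (x \in L).
  by case: b => //=; apply: mem_twisted_line_out plane labelling _ _ _ _.
have phiI b : {in Ls &, forall L M, #|phi b L :&: phi b M :&: P'| = #|L :&: M :&: P'|}.
  by case: b => //; apply: (card_twisted_lineI space plane subspace labelling).
(* Off the plane the clique clause is void and twisting leaves membership of [x] unchanged, so the
   sign [b] matters only in the inequality. *)
have twistedE x y b c : x \notin P' -> twisted_graph i j P' Ls l (x, b) (y, c)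
    = ((x, b) != (y, c)) && [exists L in Ls, (x \in L) && (y \in phi c L)].
  move=> xP; rewrite /twisted_graph /= (negPf xP) /=; congr (_ && _).
  by apply: eq_existsb => L; rewrite -/(phi b L) -/(phi c L) phi_out.
apply: (@clique_switch_cospectral _ [set v | v.1 \in P']).
- exact: twisted_graph_sym.
- move=> v w; rewrite /clique_extension2 /point_graph eq_sym; congr (_ && _).
  rewrite [v.1 == _]eq_sym; congr (_ || (_ && _)).
  by apply: eq_existsb => L; rewrite [(v.1 \in L) && _]andbC.
- by move=> v w; rewrite !inE /twisted_graph => -> ->; rewrite /= andbT.
- move=> v w; rewrite !inE => vP wP; rewrite /clique_extension2 /point_graph.
  case: eqVneq => //= _; case: eqVneq => //= _.
  (* Two plane points lie on a plane line, which is the trace of a line of the space. *)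
  have [g + /andP[vg wg]] := finite_plane_collinear plane (ltnW q2) vP wP.
  case: (subspace) => _ -> /imsetP[L]; rewrite inE => /andP[Ls_L _] gE.
  move: vg wg; rewrite gE !inE => /andP[vL _] /andP[wL _].
  by apply/existsP; exists L; rewrite Ls_L vL.
- move=> [x b] [y c]; rewrite !inE /= => xP yP.
  rewrite twistedE // /clique_extension2 /point_graph /=; congr (_ && _).
  under eq_existsb => L do rewrite phi_out //.
  (* The two copies of one point are adjacent in the twisted graph through any line on that
     point. *)
  case: eqVneq => [<-|//] /=; apply/existsP.
  have /card_gt0P[L] : 0 < #|[set L in Ls | x \in L]| by case: space => _ ->.
  by rewrite inE => /andP[Ls_L xL]; exists L; rewrite Ls_L xL.
move=> [x b] [y c]; rewrite !inE /= => xP yP.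
(* The count is independent of [psi]: it is used with [phi] for the twisted graph and with the
   identity for the clique extension. *)
have count (g : rel (T * bool)) (psi : bool -> {set T} -> {set T}) :
    (forall d, {in Ls &, forall L M, #|psi d L :&: psi d M :&: P'| = #|L :&: M :&: P'|}) ->
    (forall w a z d, w \notin P' -> z \in P' ->
       g (w, a) (z, d) = [exists L in Ls, (w \in L) && (z \in psi d L)]) ->
    #|[set v in [set v | v.1 \in P'] | g (x, b) v && g (y, c) v]|
      = \sum_(d : bool) \sum_(L in Ls | x \in L) \sum_(M in Ls | y \in M) #|L :&: M :&: P'|.
  move=> psiI gE; transitivity (\sum_(d : bool)
      #|[set z in P' | g (x, b) (z, d) && g (y, c) (z, d)]|).
    rewrite -card_set_pair; congr #|pred_of_set _|; apply/setP => -[z d].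
    by rewrite !inE.
  apply: eq_bigr => d _; rewrite -(card_common_trace space (psiI d) xP yP).
  apply: eq_card => z; rewrite !inE; case: (boolP (z \in P')) => //= zP.
  by rewrite !gE.
have neq w z : w \notin P' -> z \in P' -> w != z by move=> wP zP; apply: contraNneq wP => ->.
rewrite (count _ phi) // => [|w a z d wP zP]; last first.
  by rewrite twistedE // xpair_eqE negb_and neq.
rewrite (count _ (fun _ L => L)) // => w a z d wP zP.
rewrite /clique_extension2 /point_graph xpair_eqE negb_and /=.
by have := neq w z wP zP; case: eqVneq.
Qed.
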